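(* Let $n$ be a positive integer. The Lie algebra $\mathfrak s(n,\mathbb R)$ is generated by two matrices, i.e. there exist $X,Y\in\mathfrak s(n,\mathbb R)$ such that the smallest real Lie subalgebra of $\mathfrak s(n,\mathbb R)$ containing $X$ and $Y$ is $\mathfrak s(n,\mathbb R)$ itself.
   Context: The stochastic Lie algebra is $\mathfrak s(n,\mathbb R)=\{A\in\mathbb R^{n\times n}: A\mathbf 1=0\}$, where $\mathbf 1\in\mathbb R^n$ is the vector with all entries equal to $1$, with bracket the matrix commutator $[A,B]=AB-BA$. *)

(* Defs.v *)
From mathcomp Require Import all_boot all_order all_algebra.
From mathcomp Require Import all_classical all_reals.

Set Implicit Arguments.
Unset Strict Implicit.
Unset Printing Implicit Defensive.

Import Order.TTheory GRing.Theory Num.Theory.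
Local Open Scope classical_set_scope.
Local Open Scope ring_scope.

Definition lie_bracket (R : realType) (n : nat) (A B : 'M[R]_n) : 'M[R]_n :=
  A *m B - B *m A.

Definition stochastic_lie (R : realType) (n : nat) : set 'M[R]_n :=
  [set A | A *m (const_mx 1 : 'cV[R]_n) = 0].

Definition lie_subalgebra_of (R : realType) (n : nat) (g L : set 'M[R]_n) :
    Prop :=
  [/\ L `<=` g,
      GRing.submod_closed [in L]
    & forall A B : 'M[R]_n, L A -> L B -> L (lie_bracket A B)].

(* The intersection of all Lie subalgebras of g containing G; by
   lie_generated_subalgebra below it is itself one when g is and G `<=` g. *)
Definition lie_generated (R : realType) (n : nat) (g G : set 'M[R]_n) :
    set 'M[R]_n :=
  smallest (lie_subalgebra_of g) G.

Lemma stochastic_lie_subalgebra (R : realType) (n : nat) :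
  lie_subalgebra_of (@stochastic_lie R n) (@stochastic_lie R n).
Proof.
split=> //.
  split=> [|a A B]; rewrite !inE /stochastic_lie /= ?mul0mx //.
  by move=> hA hB; rewrite mulmxDl -scalemxAl hA hB scaler0 addr0.
move=> A B; rewrite /stochastic_lie /lie_bracket /= => hA hB.
by rewrite mulmxBl -!mulmxA hA hB !mulmx0 subr0.
Qed.

Lemma lie_generated_subalgebra (R : realType) (n : nat) (g G : set 'M[R]_n) :
  lie_subalgebra_of g g -> G `<=` g ->
  lie_subalgebra_of g (lie_generated g G).
Proof.
move=> hg Gg; split.
- exact: smallest_sub.
- split=> [|a A B]; rewrite !inE.
    by move=> L [[_ [L0 _] _] _]; rewrite inE in L0.
  move=> hA hB L hL; case: (hL) => -[_ [_ Llin] _] _.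
  by apply: set_mem; apply: Llin; apply: mem_set; [exact: hA | exact: hB].
- move=> A B hA hB L hL; case: (hL) => -[_ _ Lbr] _.
  by apply: Lbr; [exact: hA | exact: hB].
Qed.

(* Main.v *)
(* Conjugating by a frame whose first vector is the all-ones vector turns the
   condition [A 1 = 0] into the vanishing of column 0. There, take [X] diagonal
   with entries [2 ^ i - 1] and [Y] with every off-diagonal entry outside
   column 0 equal to 1. The differences [2 ^ i - 2 ^ j], [i != j], are pairwise
   distinct, so polynomials in [ad X] extract each [E_ij] from [Y]; the brackets
   [[E_ij, E_ji] = E_ii - E_jj], together with [X], whose trace is nonzero, then
   give the diagonal. *)
Require Import Defs.
From mathcomp Require Import all_boot all_order all_algebra.
From mathcomp Require Import all_classical all_reals.
From mathcomp Require Import zify ring lra.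

Import Order.TTheory GRing.Theory Num.Theory.
Local Open Scope classical_set_scope.
Local Open Scope ring_scope.

(** This is [2 ^ i - 2 ^ j = 2 ^ k - 2 ^ l] freed of truncated subtraction. A larger exponent at
    least doubles the power, so for [k < i] every ordering makes the two sides differ. *)
Lemma expn2D_inj (i j k l : nat) : i != j -> k != l ->
  (2 ^ i + 2 ^ l = 2 ^ k + 2 ^ j)%N -> i = k /\ j = l.
Proof.
have dbl a b : (a < b)%N -> (2 * 2 ^ a <= 2 ^ b)%N.
  by rewrite -expnS leq_exp2l.
wlog le_ki : i j k l / (k <= i)%N => [hw|] ij kl e.
  case: (leqP k i) => [|/ltnW] h; first exact: hw.
  by have [-> ->] := hw k l i j h kl ij (esym e).
move: le_ki; rewrite leq_eqVlt => /orP[/eqP ki|/dbl ki].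
  by split=> //; apply: (@expnI 2) => //; move: e; rewrite ki => /addnI.
have pk : (0 < 2 ^ k)%N by rewrite expn_gt0.
have pl : (0 < 2 ^ l)%N by rewrite expn_gt0.
case: (ltngtP i j) => [/dbl ij'|/dbl ij'|eij]; last by rewrite eij eqxx in ij.
  by case: (ltngtP l j) => [/dbl lj|/dbl lj|lj]; rewrite ?lj in e; lia.
by lia.
Qed.

Section LieSubalgebra.
Context {R : realType} {n : nat}.
Implicit Types (g L : set 'M[R]_n) (A B M : 'M[R]_n) (d : 'rV[R]_n).

Lemma lie_subalgebra_lin g L a A B :
  lie_subalgebra_of g L -> L A -> L B -> L (a *: A + B).
Proof.
by case=> _ [_ h] _ LA LB; apply/set_mem/h; apply/mem_set.
Qed.

Lemma lie_subalgebra0 g L : lie_subalgebra_of g L -> L 0.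
Proof. by case=> _ [/set_mem]. Qed.

Lemma lie_subalgebraZ g L a A : lie_subalgebra_of g L -> L A -> L (a *: A).
Proof.
move=> hL LA; rewrite -[a *: A]addr0.
exact: lie_subalgebra_lin hL LA (lie_subalgebra0 _ _ hL).
Qed.

Lemma lie_subalgebra_sum g L (I : finType) (P : pred I) (F : I -> 'M[R]_n) :
  lie_subalgebra_of g L -> (forall i, P i -> L (F i)) ->
  L (\sum_(i | P i) F i).
Proof.
move=> hL; apply: big_ind; first exact: lie_subalgebra0 hL.
by move=> A B LA LB; rewrite -[A]scale1r; apply: lie_subalgebra_lin hL LA LB.
Qed.

(** Conjugation is a Lie algebra automorphism, so it pulls subalgebras back to subalgebras; this
    allows work in the adapted frame. *)
Lemma lie_subalgebra_conj L (P : 'M[R]_n) : P \in unitmx ->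
  lie_subalgebra_of setT L ->
  lie_subalgebra_of setT [set A | L (P *m A *m invmx P)].
Proof.
move=> uP hL; split=> //.
  split=> [|a A B]; rewrite !inE /=.
    by rewrite mulmx0 mul0mx; apply: lie_subalgebra0 hL.
  by rewrite mulmxDr mulmxDl -scalemxAr -scalemxAl; apply: lie_subalgebra_lin hL.
move=> A B /= LA LB; have [_ _ /(_ _ _ LA LB)] := hL.
by rewrite /lie_bracket mulmxBr mulmxBl !mulmxA !(mulmxKV uP).
Qed.

Lemma lie_bracket_diag d M :
  lie_bracket (diag_mx d) M = \matrix_(i, j) ((d 0 i - d 0 j) * M i j).
Proof.
apply/matrixP=> i j; rewrite /lie_bracket mul_diag_mx mul_mx_diag !mxE.
by rewrite mulrBl [M i j * _]mulrC.
Qed.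

(** The matrix is [p] evaluated at [ad (diag_mx d)] and applied to [M]; the induction is Horner's
    rule. *)
Lemma lie_subalgebra_horner g L d M (p : {poly R}) :
  lie_subalgebra_of g L -> L (diag_mx d) -> L M ->
  L (\matrix_(i, j) (p.[d 0 i - d 0 j] * M i j)).
Proof.
move=> hL Ld LM; have [_ _ Lbr] := hL.
elim/poly_ind: p => [|p c IHp].
  rewrite (_ : \matrix_(_, _) _ = 0); first exact: lie_subalgebra0 hL.
  by apply/matrixP=> i j; rewrite !mxE horner0 mul0r.
have := lie_subalgebra_lin _ _ c _ _ hL LM (Lbr _ _ Ld IHp).
rewrite lie_bracket_diag; congr L; apply/matrixP=> i j.
by rewrite !mxE hornerMXaddC; ring.
Qed.

Lemma lie_bracket_delta (i j : 'I_n) :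
  lie_bracket (delta_mx i j) (delta_mx j i) =
  delta_mx i i - delta_mx j j :> 'M[R]_n.
Proof. by rewrite /lie_bracket !mul_delta_mx. Qed.

(* Lagrange interpolation in [ad (diag_mx d)] isolates the entry of [M] at
   [(i, j)]. *)
Lemma lie_subalgebra_delta g L d M (i j : 'I_n) :
  lie_subalgebra_of g L -> L (diag_mx d) -> L M -> M i j != 0 ->
  (forall k l, M k l != 0 -> d 0 k - d 0 l = d 0 i - d 0 j ->
     (k, l) = (i, j)) ->
  L (delta_mx i j).
Proof.
move=> hL Ld LM Mij dinj.
pose w (q : 'I_n * 'I_n) := d 0 q.1 - d 0 q.2.
(* Only positions where [M] is nonzero supply roots: elsewhere the entry stays zero, even if its
   weight equals that of [(i, j)]. *)
pose p := \prod_(q | (M q.1 q.2 != 0) && (q != (i, j))) ('X - (w q)%:P).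
have pij : p.[w (i, j)] != 0.
  rewrite horner_prod; apply/prodf_neq0 => -[k l] /andP[/= Mkl].
  rewrite hornerXsubC subr_eq0; apply: contraNneq => e.
  by apply/eqP/dinj => //; rewrite -[RHS]/(w (i, j)) e.
have := lie_subalgebraZ _ _ (p.[w (i, j)] * M i j)^-1 _ hL
  (lie_subalgebra_horner _ _ _ _ p hL Ld LM).
congr L; apply/matrixP=> k l; rewrite !mxE.
have [/eqP[-> ->]|kl] := boolP ((k, l) == (i, j)).
  by rewrite !eqxx mulVf // mulf_neq0.
rewrite -xpair_eqE (negbTE kl).
have [->|Mkl] := eqVneq (M k l) 0; first by rewrite !mulr0.
rewrite -[d 0 k - _]/(w (k, l)) /p (bigD1 (k, l)) /=; last by rewrite Mkl.
by rewrite [X in _ * (X * _)]hornerM hornerXsubC subrr !mul0r mulr0.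
Qed.

End LieSubalgebra.

Section Generators.
Context {R : realType} {m : nat}.
Local Notation n := m.+1.

(** The shift by 1 leaves differences unchanged and makes entry 0 vanish, so that [diag_mx d] has
    zero column 0. *)
Let d : 'rV[R]_n := \row_i (2 ^+ i - 1).
Let Y : 'M[R]_n := \matrix_(i, j) ((i != j) && (j != 0))%:R.

Lemma generated_col0 (L : set 'M[R]_n) (A : 'M[R]_n) :
  lie_subalgebra_of setT L -> L (diag_mx d) -> L Y -> col 0 A = 0 -> L A.
Proof.
move=> hL LX LY A0; have [_ _ Lbr] := hL.
have Loff (i j : 'I_n) : i != j -> j != 0 -> L (delta_mx i j).
  move=> ij j0; apply: (lie_subalgebra_delta _ _ _ _ _ _ hL LX LY).
    by rewrite mxE ij j0 oner_eq0.
  move=> k l; rewrite !mxE; case: (boolP (k != l)) => [kl _|]; last first.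
    by rewrite eqxx.
  move=> e; have {}e : (2 ^ k + 2 ^ j = 2 ^ i + 2 ^ l)%N.
    apply/eqP; rewrite -(eqr_nat R) !natrD !natrX; apply/eqP.
    by move: e; lra.
  by have [/val_inj-> /val_inj->] := expn2D_inj _ _ _ _ kl ij e.
have Ldiag (k : 'I_n) : k != 0 -> L (delta_mx k k).
  move=> k0.
  have dge (i : 'I_n) : 0 <= d 0 i.
    by rewrite mxE subr_ge0 exprn_ege1 // ler1n.
  have s0 : \sum_i d 0 i != 0.
    rewrite gt_eqF // (bigD1 k) //= ltr_pwDl ?sumr_ge0 // mxE subr_gt0.
    by rewrite exprn_egt1 // ltr1n.
  (* Summed over [i] and added to [diag_mx d], these give the trace times [delta_mx k k]. At [i = 0]
     the bracket would involve [delta_mx k 0], which has a nonzero column 0, but the coefficient is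
     zero. *)
  have Lsub (i : 'I_n) : L (d 0 i *: (delta_mx k k - delta_mx i i)).
    have [->|i0] := eqVneq i 0.
      by rewrite mxE expr0 subrr scale0r; apply: lie_subalgebra0 hL.
    have [->|ik] := eqVneq i k.
      by rewrite subrr scaler0; apply: lie_subalgebra0 hL.
    apply: lie_subalgebraZ hL _; rewrite -lie_bracket_delta.
    by apply: Lbr; apply: Loff => //; rewrite eq_sym.
  have LS := lie_subalgebra_sum _ _ _ xpredT _ hL (fun i _ => Lsub i).
  have := lie_subalgebraZ _ _ (\sum_i d 0 i)^-1 _ hL
    (lie_subalgebra_lin _ _ 1 _ _ hL LX LS).
  congr L; rewrite scale1r diag_mx_sum_delta -big_split /=.
  rewrite (eq_bigr (fun i => d 0 i *: delta_mx k k)) => [|i _].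
    by rewrite -scaler_suml scalerA mulVf // scale1r.
  by rewrite -[LHS]scalerDr [_ + (_ - _)]addrC subrK.
rewrite [A]matrix_sum_delta; apply: (lie_subalgebra_sum _ _ _ _ _ hL) => i _.
apply: (lie_subalgebra_sum _ _ _ _ _ hL) => j _.
have [->|j0] := eqVneq j 0.
  move/colP/(_ i): A0; rewrite !mxE => ->; rewrite scale0r.
  exact: lie_subalgebra0 hL.
apply: (lie_subalgebraZ _ _ _ _ hL).
by have [->|ij] := eqVneq i j; [apply: Ldiag | apply: Loff].
Qed.

(** The frame: column 0 is the all-ones vector and the others are standard basis vectors, so [P] is
    lower unitriangular. *)
Let P : 'M[R]_n := \matrix_(i, j) ((i == j) || (j == 0))%:R.

Lemma frame_unitmx : P \in unitmx.
Proof.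
rewrite unitmxE det_trig; last first.
  apply/is_trig_mxP => i j ij; rewrite mxE -!val_eqE /=.
  by rewrite ltn_eqF // gtn_eqF // (leq_trans _ ij).
by rewrite big1 ?unitr1 // => i _; rewrite mxE eqxx.
Qed.

(** Since [P] sends the first basis vector to the all-ones vector, this column is [invmx P] applied
    to [A 1]. *)
Lemma stochastic_lieE (A : 'M[R]_n) :
  stochastic_lie A <-> col 0 (invmx P *m A *m P) = 0.
Proof.
have P0 : P *m delta_mx 0 0 = const_mx 1 :> 'cV[R]_n.
  by rewrite -colE; apply/colP=> i; rewrite !mxE eqxx orbT.
rewrite colE -!mulmxA P0 /stochastic_lie /=; split=> [->|].
  by rewrite mulmx0.
by move/(congr1 (mulmx P)); rewrite mulKVmx ?frame_unitmx // mulmx0.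
Qed.

Lemma stochastic_two_generators :
  exists X Y : 'M[R]_n,
    [/\ stochastic_lie X, stochastic_lie Y
      & lie_generated (@stochastic_lie R n) [set X; Y] = @stochastic_lie R n].
Proof.
have uP := frame_unitmx.
pose c (A : 'M[R]_n) := P *m A *m invmx P.
have cK (A : 'M[R]_n) : invmx P *m c A *m P = A.
  by rewrite /c !mulmxA mulVmx // mul1mx mulmxKV.
have sX : stochastic_lie (c (diag_mx d)).
  apply/stochastic_lieE; rewrite cK; apply/colP=> i; rewrite !mxE.
  by case: eqVneq => [->|]; rewrite ?expr0 ?subrr ?mul0rn.
have sY : stochastic_lie (c Y).
  by apply/stochastic_lieE; rewrite cK; apply/colP=> i; rewrite !mxE andbF.
exists (c (diag_mx d)), (c Y); split=> //.
have sub : [set c (diag_mx d); c Y] `<=` @stochastic_lie R n by move=> _ [] ->.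
apply/seteqP; split; first exact: smallest_sub (stochastic_lie_subalgebra _ _) _.
move=> A /stochastic_lieE A0 L [[_ Llin Lbr] LG].
have hL : lie_subalgebra_of setT L by split.
(* The pullback of [L] along [c] contains [diag_mx d] and [Y], hence also [invmx P *m A *m P], whose
   image under [c] is [A]. *)
have := generated_col0 _ _ (lie_subalgebra_conj _ _ uP hL)
  (LG _ (or_introl erefl)) (LG _ (or_intror erefl)) A0.
by rewrite /= !mulmxA mulmxV // mul1mx mulmxK.
Qed.

End Generators.

Theorem theorem7p1 (R : realType) (n : nat) (hn : (0 < n)%N) :
  exists X Y : 'M[R]_n,
    [/\ stochastic_lie X,
        stochastic_lie Y
      & lie_generated (@stochastic_lie R n) [set X; Y] = @stochastic_lie R n].
Proof. by case: n hn => // m _; apply: stochastic_two_generators. Qed.
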